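(* Let $G\subset\mathbb{C}$ be a simply connected domain. Assume that $\varphi\in\mathrm{Aut}(G)$ and that $\varphi$ has no fixed points in $G$. Then for every $f\in HC(C_\varphi)$ there is a family $\mathcal{F}\subset\mathcal{H}(G)$ satisfying the following properties: (a) $f\in\mathcal{F}\subset HC(C_\varphi)$. (b) $\mathcal{F}$ is dense in $\mathcal{H}(G)$. (c) For each finite nonempty subfamily $\mathcal{F}_0\subset\mathcal{F}$, one has $\prod_{g\in\mathcal{F}_0}g\in HC(C_\varphi)$. (d) $\mathcal{F}$ is a linearly free system (i.e. linearly independent).
   Context: A domain in $\mathbb{C}$ is a nonempty connected open subset $G\subset\mathbb{C}$; it is simply connected if $\mathbb{C}_\infty\setminus G$ is connected, where $\mathbb{C}_\infty$ is the extended complex plane (Riemann sphere). $\mathcal{H}(G)$ is the space of holomorphic functions $G\to\mathbb{C}$ with the topology of uniform convergence on compact subsets of $G$. $\mathrm{Aut}(G)$ is the group of bijective holomorphic functions $G\to G$. For a holomorphic $\varphi:G\to G$, the composition operator $C_\varphi:\mathcal{H}(G)\to\mathcal{H}(G)$ is $C_\varphi f=f\circ\varphi$. For a continuous linear operator $T$ on a topological vector space $X$, $HC(T)$ denotes the set of hypercyclic vectors of $T$, i.e. of those $x\in X$ whose orbit $\{T^nx:n\in\mathbb{N}\}$, $\mathbb{N}=\{1,2,\dots\}$, is dense in $X$. The product in (c) is the pointwise product of the (distinct) members of the finite set $\mathcal{F}_0$. *)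

(* Defs.v *)
From HB Require Import structures.
From mathcomp Require Import all_boot all_order all_algebra complex finmap.
From mathcomp Require Import all_classical all_reals all_analysis.

Set Implicit Arguments.
Unset Strict Implicit.
Unset Printing Implicit Defensive.

Import Order.TTheory GRing.Theory Num.Theory numFieldNormedType.Exports.

Local Open Scope classical_set_scope.
Local Open Scope ring_scope.

(* [R[i]] itself carries no topology in the library; seen as an element of
   [numClosedFieldType] it is a normed module over itself, so that
   [derivable f z 1] is complex differentiability of [f] at [z]. *)
Definition Cplx (R : realType) : numClosedFieldType := R[i].

Record domain (R : realType) := Domain {
  domain_set :> set (Cplx R);
  domain_neq0 : domain_set !=set0;
  domain_open : open domain_set;
  domain_connected : connected domain_set }.

Definition simply_connected (R : realType) (G : domain R) : Prop :=
  connected (~` [set Some z | z in G] :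
    set (one_point_compactification (Cplx R))).

(* A function on [G] is extended by 0 outside [G]; since [G] is open this does
   not affect differentiability at the points of [G]. *)
Definition holomorphic (R : realType) (G : domain R) (f : G -> Cplx R) : Prop :=
  forall z : G, derivable ('valL_ 0 f) (val z) 1.

Section valL_lemmas.
Context (R : realType) (G : domain R).
Implicit Types (f g : G -> Cplx R) (z : G).

Lemma valL_val f z : 'valL_ 0 f (val z) = f z.
Proof.
have := congr1 (@^~ z) (valLK (0 : Cplx R) f).
by rewrite /sigL /=.
Qed.

Lemma domain_valP z : domain_set G (val z).
Proof. by have := valP z; rewrite inE. Qed.

Lemma valL_near f (F : Cplx R -> Cplx R) z :
  (forall w : G, F (val w) = f w) -> {near val z, F =1 'valL_ 0 f}.
Proof.
move=> FE; have /open_nbhs_nbhs : open_nbhs (val z) (domain_set G).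
  by split; [exact: domain_open | exact: domain_valP].
apply: filterS => w Gw.
by have -> : w = val (exist _ w (mem_set Gw) : G) by []; rewrite FE valL_val.
Qed.

Lemma holomorphic_ext f (F : Cplx R -> Cplx R) :
  (forall w : G, F (val w) = f w) ->
  (forall z : G, derivable F (val z) 1) -> holomorphic f.
Proof.
by move=> FE dF z; apply: near_eq_derivable (dF z); exact: valL_near.
Qed.

End valL_lemmas.

Section holomorphic_closed.
Context (R : realType) (G : domain R).

Definition holomorphic_pred : {pred G -> Cplx R} := mem [set f | holomorphic f].

Lemma holomorphic_predP f : reflect (holomorphic f) (f \in holomorphic_pred).
Proof. by apply: (iffP idP); rewrite !inE. Qed.

Let holomorphic_subring : subring_closed holomorphic_pred.
Proof.
split.
- apply/holomorphic_predP.
  by apply: (holomorphic_ext (F := cst (1 : Cplx R))).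
- move=> f g /holomorphic_predP hf /holomorphic_predP hg.
  apply/holomorphic_predP.
  apply: (holomorphic_ext (F := 'valL_ 0 f - 'valL_ 0 g)) => [w|z].
    by rewrite !fctE !valL_val.
  exact: derivableB.
- move=> f g /holomorphic_predP hf /holomorphic_predP hg.
  apply/holomorphic_predP.
  apply: (holomorphic_ext (F := 'valL_ 0 f * 'valL_ 0 g)) => [w|z].
    by rewrite !fctE !valL_val.
  exact: derivableM.
Qed.

Let holomorphic_scale : GRing.scaler_closed holomorphic_pred.
Proof.
move=> k f /holomorphic_predP hf; apply/holomorphic_predP.
apply: (holomorphic_ext (F := k \*: 'valL_ 0 f)) => [w|z].
  exact: (congr1 ( *%R k) (valL_val f w)).
exact: derivableZ.
Qed.

HB.instance Definition _ :=
  GRing.isSubringClosed.Build _ holomorphic_pred holomorphic_subring.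
HB.instance Definition _ :=
  GRing.isScaleClosed.Build _ _ holomorphic_pred holomorphic_scale.

End holomorphic_closed.

Section hol.
Context (R : realType) (G : domain R).

Record hol := Hol {
  hol_fun :> G -> Cplx R;
  hol_in : hol_fun \in @holomorphic_pred R G }.

HB.instance Definition _ := [isSub for hol_fun].
HB.instance Definition _ := [Choice of hol by <:].
HB.instance Definition _ :=
  GRing.SubChoice_isSubComPzRing.Build _ _ hol (GRing.subringClosedP _).
HB.instance Definition _ := [SubZmodule_isSubLmodule of hol by <:].

Definition hol_compact (f : hol) : {family compact, G -> Cplx R} := hol_fun f.

HB.instance Definition _ := Uniform.copy hol (initial_topology hol_compact).

End hol.

Record selfmap (R : realType) (G : domain R) := SelfMap {
  selfmap_fun :> G -> G;
  selfmap_holomorphic : holomorphic (fun z : G => val (selfmap_fun z)) }.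

Definition Aut (R : realType) (G : domain R) : set (selfmap G) :=
  [set phi : selfmap G | bijective phi].
Arguments Aut {R} G.

Section comp_op.
Context (R : realType) (G : domain R) (phi : selfmap G).

Lemma holomorphic_comp (f : hol G) :
  (fun z : G => f (phi z)) \in @holomorphic_pred R G.
Proof.
apply/holomorphic_predP.
pose F := 'valL_ 0 f \o 'valL_ 0 (fun z : G => val (phi z)).
apply: (holomorphic_ext (F := F)) => [w|z].
  by rewrite /F /comp !valL_val.
have hf := holomorphic_predP _ (hol_in f).
apply/derivable1_diffP/differentiable_comp; apply/derivable1_diffP.
  exact: selfmap_holomorphic.
by rewrite valL_val; exact: hf.
Qed.

Definition comp_op (f : hol G) : hol G := Hol (holomorphic_comp f).

End comp_op.

Definition HC (X : topologicalType) (T : X -> X) : set X :=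
  [set x | dense [set iter n T x | n in [set n | (0 < n)%N]]].

Definition linearly_independent (K : pzRingType) (V : lmodType K)
    (F : set V) : Prop :=
  forall (F0 : {fset V}) (c : V -> K), [set` F0] `<=` F ->
    \sum_(v <- F0) c v *: v = 0 -> {in F0, forall v, c v = 0}.

(* Main.v *)
Require Import Defs.
From mathcomp Require Import all_boot all_order all_algebra complex finmap.
From mathcomp Require Import all_classical all_reals all_analysis.
From mathcomp Require Import ring lra.
Import GRing.Theory.
Import Order.TTheory Num.Theory numFieldNormedType.Exports.
Local Open Scope classical_set_scope.
Local Open Scope ring_scope.

Set Implicit Arguments.
Unset Strict Implicit.
Unset Printing Implicit Defensive.

(** Write [T] for the composition operator, [f] for the given hypercyclic
    vector, and put
      [g_n = T^n f * (1 - d_n e^f)], with [d_0 = 0] and [d_n = e^-n] for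
      [n >= 1].
    The family is [{g_n | n in nat}]; it contains [f = g_0].  Everything is
    deduced from the density of the orbit of [f]: every holomorphic [w] is
    approximated, uniformly on any given compact set, by some [T^j f], and
    applying this on the compact union of [phi^k(K)], for finitely many [k],
    shows that then [T^k (T^j f)] approximates [T^k w] on [K] for all these [k].
    So in order to approximate [v] by the orbit of a product of members of the
    family it suffices to find [w] for which the corresponding expression in
    [w, T w, T^2 w, ...] is close to [v].

    Products (lemma [prod_twist_HC]).  Consider a product of members that
    involves [g_n] with [n >= 1], the only one with coefficient [d_n].  The
    constants [a = n + 2 i pi m] satisfy [d_n e^a = 1] and tend to infinity with
    [m].  Constants are fixed by [T], so at [w = a + u / rho], with [rho] large,
    each factor [T^k w] is [a (1 + o(1))], the factors [1 - d_k e^w] with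
    [k <> n] tend to the nonzero constants [1 - d_k / d_n], while
    [1 - d_n e^w = 1 - e^(u / rho)] is [- u / rho (1 + o(1))].  Taking for [rho]
    the product of all the constant factors, a power of [a] times a nonzero
    constant, makes the whole product converge to [u].  The factor [T^n w],
    which tends to infinity, is what makes [rho] large: without it the zeros of
    [1 - d_n e^z] could not be magnified.

    Density (lemma [dense_twisted_orbit]).  On a compact set [d_n e^f] tends to
    [0], and the functions [T^n f] with [n] large are still dense, so [g_n] is
    close to [T^n f] whenever the latter is close to a prescribed function.

    Independence (lemma [linearly_independent_twisted_orbit]).  A linear
    relation between the [g_n], transported along the orbit, holds at a point
    [z0] with [f] replaced by any holomorphic [w].  The points [phi^k(z0)] are
    pairwise distinct, so a polynomial [w] can be chosen to vanish at all of
    those that occur except one, which isolates a single coefficient. *)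

(** * Norms and limits of complex numbers *)

Section complex_limits.
Context (R : realType).
Local Open Scope complex_scope.
Implicit Types (x e : Cplx R).

Lemma Re_normE x : (complex.Re `|x|)%:C = `|x|.
Proof. by rewrite RRe_real// normr_real. Qed.

Lemma Re_norm_ge0 x : 0 <= complex.Re `|x|.
Proof. by rewrite -lecR Re_normE; exact: normr_ge0. Qed.

Lemma gt0_real_complex e : 0 < e -> exists2 r : R, 0 < r & e = r%:C.
Proof.
move=> e0; have eE : e = (complex.Re e)%:C by rewrite RRe_real// gtr0_real.
by exists (complex.Re e) => //; rewrite -ltcR -eE.
Qed.

Lemma norm_real_complex (r : R) : `|r%:C : Cplx R| = `|r|%:C.
Proof. by rewrite normc_def /= expr0n addr0 sqrtr_sqr. Qed.

Lemma norm_complex_le (a b : R) :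
  `|(Complex a b : Cplx R)| <= (`|a| + `|b|)%:C.
Proof.
rewrite normc_def lecR/= -[leRHS]ger0_norm ?addr_ge0//.
rewrite -sqrtr_sqr ler_sqrt ?sqr_ge0//.
by rewrite sqrrD !real_normK ?num_real// lerD2r lerDl mulrn_wge0.
Qed.

Lemma continuous_Re : continuous (fun x => complex.Re x).
Proof.
move=> z; apply/(@cvgrPdist_lt R R (Cplx R) (nbhs z)) => e e0; near=> w.
rewrite -ltcR; apply: le_lt_trans (_ : `|z - w| < e%:C).
  by rewrite -raddfB; exact: normc_ge_Re.
by near: w; apply: nbhsx_ballx; rewrite ltcR.
Unshelve. all: by end_near. Qed.

Section filters.
Context (X : Type) (F : set_system X) {FF : Filter F}.
Implicit Types g h : X -> Cplx R.

Lemma cvg_near_eq g h (l : Cplx R) :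
  (\forall t \near F, g t = h t) -> g @ F --> l -> h @ F --> l.
Proof. by move=> gh gl; apply: cvg_trans gl; exact: near_eq_cvg. Qed.

Lemma cvg_dominated g (u : X -> R) :
  (\forall t \near F, `|g t| <= (u t)%:C) -> u @ F --> 0 ->
  g @ F --> (0 : Cplx R).
Proof.
move=> gu u0; apply/(@cvgr0Pnorm_lt (Cplx R) (Cplx R)).
move=> _ /gt0_real_complex[e e0 ->].
move/(@cvgr0Pnorm_lt R R) : u0 => /(_ _ e0) u0.
near=> t; apply: le_lt_trans (_ : (u t)%:C < _); first by near: t.
by rewrite ltcR; apply: le_lt_trans (ler_norm _) _; near: t.
Unshelve. all: by end_near. Qed.

Lemma cvg_bounded_mul g h (M : R) :
  (\forall t \near F, `|g t| <= M%:C) -> h @ F --> (0 : Cplx R) ->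
  (fun t => g t * h t) @ F --> (0 : Cplx R).
Proof.
move=> gM h0; apply/(@cvgr0Pnorm_lt (Cplx R) (Cplx R)) => e e0.
(* [M] itself may be [0] *)
have M0 : 0 < (`|M| + 1)%:C :> Cplx R by rewrite ltcR ltr_wpDl.
have := h0; move/(@cvgr0Pnorm_lt (Cplx R) (Cplx R)).
move=> /(_ (e / (`|M| + 1)%:C)); rewrite divr_gt0// => /(_ isT) {}h0.
near=> t; have gt : `|g t| <= (`|M| + 1)%:C.
  apply: le_trans (_ : M%:C <= _); first by near: t.
  by rewrite lecR (le_trans (ler_norm _))// lerDl.
rewrite normrM; apply: le_lt_trans (_ : (`|M| + 1)%:C * `|h t| < e).
  exact: ler_wpM2r.
by rewrite mulrC -ltr_pdivlMr//; near: t.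
Unshelve. all: by end_near. Qed.

Lemma cvg_exprS0 g (n : nat) :
  g @ F --> (0 : Cplx R) -> (fun t => g t ^+ n.+1) @ F --> (0 : Cplx R).
Proof.
move=> g0; elim: n => [|n IH]; first exact: g0.
by rewrite -(mul0r (0 : Cplx R)); under eq_fun do rewrite exprS; exact: cvgM.
Qed.

Lemma cvg_sum_seq (I : eqType) (s : seq I) (h : I -> X -> Cplx R)
    (l : I -> Cplx R) :
  (forall i, i \in s -> h i @ F --> l i) ->
  (fun t => \sum_(i <- s) h i t) @ F --> \sum_(i <- s) l i.
Proof.
move=> hl; rewrite [X in _ --> X]big_seq; under eq_fun do rewrite big_seq.
by apply: cvg_big => //; exact: add_continuous.
Qed.

Lemma cvg_prod_seq (I : eqType) (s : seq I) (h : I -> X -> Cplx R)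
    (l : I -> Cplx R) :
  (forall i, i \in s -> h i @ F --> l i) ->
  (fun t => \prod_(i <- s) h i t) @ F --> \prod_(i <- s) l i.
Proof.
move=> hl; rewrite [X in _ --> X]big_seq; under eq_fun do rewrite big_seq.
by apply: cvg_big => //; exact: mul_continuous.
Qed.

End filters.

Lemma near_shift_ge (a p : Cplx R) (M : R) : p != 0 ->
  \forall m \near \oo, M%:C <= `|a + p *+ m|.
Proof.
move=> p0; have p0' : 0 < complex.Re `|p| by rewrite -ltcR Re_normE normr_gt0.
near=> m.
have : (M + complex.Re `|a|) / complex.Re `|p| <= m%:R.
  by near: m; exact: nbhs_infty_ger.
have := lerB_normD (p *+ m) a; rewrite [p *+ m + a]addrC => H H'.
apply: le_trans H; move: H'.
rewrite lerBrDr normrMn -(Re_normE p) -(Re_normE a) -rmorphMn -rmorphD lecR/=.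
by rewrite ler_pdivrMr// mulr_natl.
Unshelve. all: by end_near. Qed.

Lemma cvg_inv_shift (a p : Cplx R) : p != 0 ->
  (fun m => (a + p *+ m)^-1) @ \oo --> (0 : Cplx R).
Proof.
move=> p0; apply/(@cvgr0Pnorm_le (Cplx R) (Cplx R)) => e e0.
have e0' : 0 < e^-1 by rewrite invr_gt0.
have [r r0 eE] := gt0_real_complex e0.
near=> m; have H : e^-1 <= `|a + p *+ m|.
  by rewrite eE -fmorphV; near: m; exact: near_shift_ge.
rewrite normfV -[leRHS]invrK lef_pV2 ?posrE//.
exact: lt_le_trans H.
Unshelve. all: by end_near. Qed.

End complex_limits.

(** The filter of pairs [(m, y)] with [m] large and [y] anywhere in [K]:
    convergence along it is convergence as [m] tends to infinity, uniformly for
    [y] in [K], and the usual rules on limits apply to it. *)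
Lemma uniform_filterP (Y : Type) (K : set Y) :
  exists F : set_system (nat * Y), [/\ Filter F,
    forall S : set nat, (\forall m \near \oo, S m) ->
      \forall x \near F, S x.1,
    \forall x \near F, K x.2 &
    forall S : set (nat * Y), F S -> exists m, forall y, K y -> S (m, y)].
Proof.
exists (filter_prod \oo (globally K)); split.
- exact: filter_prod_filter.
- by move=> S HS; exists (S, setT) => //= -[m z] [].
- exists (setT, K) => /=; last by move=> -[m z] [].
  by split => //; exact: filterT.
- move=> S [[A B] /= [A1 B1] AB].
  have [m Am] := @filter_ex _ \oo _ A A1.
  by exists m => y Ky; apply: (AB (m, y)); split => //=; exact: B1.
Qed.

(** * The complex exponential *)

Section complex_exponential.
Context (R : realType).
Local Open Scope complex_scope.
Implicit Types z w : Cplx R.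

Definition expC z : Cplx R :=
  Complex (expR (complex.Re z) * cos (complex.Im z))
    (expR (complex.Re z) * sin (complex.Im z)).

Lemma expCD z w : expC (z + w) = expC z * expC w.
Proof.
case: z w => [a b] [c d]; apply/eqP; rewrite eq_complex /= expRD cosD sinD.
by apply/andP; split; apply/eqP; ring.
Qed.

Lemma expC0 : expC 0 = 1.
Proof.
by apply/eqP; rewrite eq_complex /= expR0 cos0 sin0 mulr1 mulr0 !eqxx.
Qed.

Lemma expC_real (r : R) : expC r%:C = (expR r)%:C.
Proof.
by apply/eqP; rewrite eq_complex /= cos0 sin0 mulr1 mulr0 !eqxx.
Qed.

Definition log_period : Cplx R := Complex 0 (pi *+ 2).

Lemma log_period_neq0 : log_period != 0.
Proof.
by rewrite eq_complex /= eqxx/= mulrn_eq0/= gt_eqF// pi_gt0.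
Qed.

Lemma expC_period z m : expC (z + log_period *+ m) = expC z.
Proof.
elim: m => [|m IH]; first by rewrite mulr0n addr0.
rewrite mulrSr addrA expCD IH [expC log_period](_ : _ = 1) ?mulr1//.
by apply/eqP; rewrite eq_complex /= expR0 cos2pi sin2pi !mul1r !eqxx.
Qed.

Lemma is_derive_bound (g : R -> R) (d e : R) :
  is_derive (0 : R) 1 g d -> 0 < e ->
  exists2 r : R, 0 < r & forall x, `|x| < r -> `|g x - g 0 - d * x| <= e * `|x|.
Proof.
move=> [dg dE] e0.
move: dg => /cvgrPdist_le /(_ _ e0); rewrite /dnbhs/= near_withinE.
move=> /nbhs_ballP[r/= r0 rP]; exists r => // x xr.
have [->|x0] := eqVneq x 0; first by rewrite subrr mulr0 subrr normr0 mulr0.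
have := rP x; rewrite /ball/= sub0r normrN => /(_ xr x0).
have -> : lim (h^-1 *: (g (h *: 1 + 0) - g 0) @[h --> 0^']) = d by exact: dE.
rewrite addr0 /GRing.scale/= mulr1 => H.
have -> : g x - g 0 - d * x = - (x * (d - x^-1 * (g x - g 0))) by field.
by rewrite normrN normrM mulrC ler_pM2r ?normr_gt0.
Qed.

(** Complex differentiability of the exponential at [0], from the real
    derivatives at [0] of [expR], [cos] and [sin]: with [E], [c], [s] their
    values, the real and imaginary parts of [expC z - 1 - z] are
    [(E - 1 - x) + E (c - 1)] and [E (s - y) + (E - 1) y]. *)
Lemma expC_first_order (e : R) : 0 < e ->
  exists2 r : R, 0 < r &
    forall z, `|z| < r%:C -> `|expC z - 1 - z| <= e%:C * `|z|.
Proof.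
move=> e0; pose e' := Num.min (e / 8) 1.
have e'0 : 0 < e' by rewrite lt_min ltr01 andbT divr_gt0.
have e'1 : e' <= 1 by rewrite ge_min lexx orbT.
have e'e : e' * 8 <= e by rewrite -ler_pdivlMr// ge_min lexx.
have dexp : is_derive (0 : R) 1 expR (1 : R).
  by have := is_derive_expR (0 : R); rewrite expR0.
have dcos : is_derive (0 : R) 1 (@cos R) 0.
  by have := is_derive_cos (0 : R); rewrite sin0 oppr0.
have dsin : is_derive (0 : R) 1 (@sin R) 1.
  by have := is_derive_sin (0 : R); rewrite cos0.
have [r1 r10 H1] := is_derive_bound dexp e'0.
have [r2 r20 H2] := is_derive_bound dcos e'0.
have [r3 r30 H3] := is_derive_bound dsin e'0.
pose r := Num.min (Num.min r1 r2) (Num.min r3 (e' / 2)).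
exists r; first by rewrite !lt_min r10 r20 r30 divr_gt0.
move=> [x y]; rewrite normc_def ltcR -rmorphM lecR/=; set n := Num.sqrt _ => nr.
have xn : `|x| <= n by rewrite -sqrtr_sqr ler_sqrt ?lerDl ?addr_ge0 ?sqr_ge0.
have yn : `|y| <= n by rewrite -sqrtr_sqr ler_sqrt ?lerDr ?addr_ge0 ?sqr_ge0.
move: nr; rewrite !lt_min => /andP[/andP[n1 n2] /andP[n3 n4]].
have := H1 _ (le_lt_trans xn n1); rewrite expR0 mul1r => {}H1.
have := H2 _ (le_lt_trans yn n2); rewrite cos0 mul0r subr0 => {}H2.
have := H3 _ (le_lt_trans yn n3); rewrite sin0 subr0 mul1r => {}H3.
rewrite -lecR.
apply: (@le_trans _ _
    `|(Complex (expR x * cos y - 1 - x) (expR x * sin y - y) : Cplx R)|).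
  by rewrite normc_def subr0.
apply: le_trans (norm_complex_le _ _) _; rewrite lecR.
set E := expR x in H1 *; set c := cos y in H2 *; set s := sin y in H3 *.
have n0 : 0 <= n by apply: sqrtr_ge0.
have E1 : `|E - 1| <= 2 * `|x|.
  rewrite (_ : E - 1 = (E - 1 - x) + x); last by ring.
  apply: le_trans (ler_normD _ _) _; rewrite [leRHS]mulrDl mul1r lerD//.
  apply: le_trans H1 _; exact: ler_piMl.
have E2 : `|E| <= 2.
  rewrite (_ : E = (E - 1) + 1); last by ring.
  apply: le_trans (ler_normD _ _) _; rewrite normr1.
  have : `|x| <= 1 / 2 by lra.
  lra.
have -> : E * c - 1 - x = (E - 1 - x) + E * (c - 1) by ring.
have -> : E * s - y = E * (s - y) + (E - 1) * y by ring.
have A1 : `|E * (c - 1)| <= 2 * (e' * n).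
  by rewrite normrM ler_pM//; apply: le_trans H2 _; rewrite ler_pM2l.
have A2 : `|E * (s - y)| <= 2 * (e' * n).
  by rewrite normrM ler_pM//; apply: le_trans H3 _; rewrite ler_pM2l.
have A3 : `|(E - 1) * y| <= e' * n by rewrite normrM ler_pM//; lra.
have A4 : `|E - 1 - x| <= e' * n.
  by apply: le_trans H1 _; rewrite ler_pM2l.
have B1 := ler_normD (E - 1 - x) (E * (c - 1)).
have B2 := ler_normD (E * (s - y)) ((E - 1) * y).
have : e' * 8 * n <= e * n by rewrite ler_wpM2r.
have : 0 <= e' * n by rewrite mulr_ge0// ltW.
lra.
Qed.

Definition expC_quot z : Cplx R := if z == 0 then 1 else (expC z - 1) / z.

Lemma expC_quotE z : expC z - 1 = z * expC_quot z.
Proof.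
rewrite /expC_quot; case: eqVneq => [->|z0]; first by rewrite expC0 subrr mul0r.
by rewrite mulrC divfK.
Qed.

Lemma cvg_expC_quot : expC_quot @ nbhs (0 : Cplx R) --> (1 : Cplx R).
Proof.
apply/(@cvgrPdist_le (Cplx R) (Cplx R) (Cplx R) (nbhs (0 : Cplx R))).
move=> _ /gt0_real_complex[e e0 ->].
have [r r0 rP] := expC_first_order e0.
near=> z; rewrite /expC_quot; case: eqVneq => [_|z0].
  by rewrite subrr normr0 lecR ltW.
have -> : 1 - (expC z - 1) / z = - ((expC z - 1 - z) / z).
  by rewrite [in RHS]mulrBl divff// opprB.
rewrite normrN normrM normfV ler_pdivrMr ?normr_gt0//; apply: rP.
rewrite -[z]subr0 distrC; near: z.
by apply: nbhsx_ballx; rewrite ltcR.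
Unshelve. all: by end_near. Qed.

Lemma derivable_expC z : derivable expC z 1.
Proof.
apply/cvg_ex; exists (expC z * 1).
apply: (@cvg_trans _ (expC z * expC_quot h @[h --> 0^'])).
  apply: near_eq_cvg; near=> h.
  have h0 : h != 0 by near: h; exact: nbhs_dnbhs_neq.
  have -> : (expC \o shift z) h%:A - expC z = h * (expC z * expC_quot h).
    by rewrite /= /shift/= [h%:A]mulr1 expCD mulrCA -expC_quotE; ring.
  by rewrite /GRing.scale/= mulKf.
apply: cvgMr; apply: cvg_trans cvg_expC_quot.
exact/cvg_app/nbhs_dnbhs.
Unshelve. all: by end_near. Qed.

Lemma continuous_expC : continuous expC.
Proof.
by move=> z; apply/differentiable_continuous/derivable1_diffP/derivable_expC.
Qed.

End complex_exponential.

(** * Holomorphic functions and compact convergence *)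

Section hol_algebra.
Context (R : realType) (G : domain R).
Implicit Types (g h : hol G) (z : G) (c : Cplx R).

Lemma domain_point : exists z, True.
Proof. by have [x Gx] := domain_neq0 G; exists (exist _ x (mem_set Gx)). Qed.

Lemma holD g h z : (g + h) z = g z + h z. Proof. by []. Qed.

Lemma holB g h z : (g - h) z = g z - h z. Proof. by []. Qed.

Lemma holM g h z : (g * h) z = g z * h z. Proof. by []. Qed.

Lemma hol1 z : (1 : hol G) z = 1. Proof. by []. Qed.

Lemma holZ c g z : (c *: g) z = c * g z. Proof. by []. Qed.

Lemma hol_sum (I : Type) (s : seq I) (P : pred I) (g : I -> hol G) z :
  (\sum_(i <- s | P i) g i) z = \sum_(i <- s | P i) g i z.
Proof. by elim/big_rec2 : _ => // i a b _ <-. Qed.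

Lemma hol_prod (I : Type) (s : seq I) (P : pred I) (g : I -> hol G) z :
  (\prod_(i <- s | P i) g i) z = \prod_(i <- s | P i) g i z.
Proof. by elim/big_rec2 : _ => // i a b _ <-. Qed.

Definition hol_cst c : hol G := c *: (1 : hol G).

Lemma hol_cstE c z : hol_cst c z = c. Proof. exact: mulr1. Qed.

Lemma holomorphic_exp g : (fun z => expC (g z)) \in @holomorphic_pred R G.
Proof.
apply/holomorphic_predP.
apply: (holomorphic_ext (F := @expC R \o 'valL_ 0 g)) => [w|z].
  by rewrite /comp valL_val.
apply/derivable1_diffP/differentiable_comp; apply/derivable1_diffP.
  exact: (holomorphic_predP _ (hol_in g)).
exact: derivable_expC.
Qed.

Definition hol_exp g : hol G := Hol (holomorphic_exp g).

Lemma holomorphic_val : (fun z : G => val z) \in @holomorphic_pred R G.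
Proof.
apply/holomorphic_predP.
by apply: (holomorphic_ext (F := id)) => // z; exact: derivable_id.
Qed.

Definition hol_val : hol G := Hol holomorphic_val.

End hol_algebra.

Section hol_topology.
Context (R : realType) (G : domain R).
Local Open Scope complex_scope.

Lemma continuous_holomorphic (f : G -> Cplx R) :
  holomorphic f -> continuous f.
Proof.
move=> hf z; have fE : f = 'valL_ 0 f \o val.
  by apply/funext => w; exact: esym (valL_val f w).
rewrite [X in continuous_at _ X]fE; apply: continuous_comp.
  exact: (@initial_continuous _ _ (@set_val _ G) z).
exact/differentiable_continuous/derivable1_diffP/hf.
Qed.

Lemma continuous_hol (f : hol G) : continuous f.
Proof. exact/continuous_holomorphic/holomorphic_predP/hol_in. Qed.

Lemma continuous_selfmap (phi : selfmap G) : continuous phi.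
Proof.
have C := continuous_holomorphic (@selfmap_holomorphic _ _ phi).
apply/continuousP => A [B oB <-].
by move/continuousP : C => /(_ _ oB).
Qed.

Lemma hol_bounded (f : hol G) (K : set G) : compact K ->
  exists2 M : R, 0 < M & forall z, K z -> `|f z| <= M%:C.
Proof.
move=> cK.
pose g z : R := complex.Re `|f z|.
have cg : continuous g.
  move=> z; apply: (@continuous_comp _ _ _ (fun z => `|f z|)
    (fun z : Cplx R => complex.Re z)).
    by apply: continuous_comp; [exact: continuous_hol | exact: norm_continuous].
  exact: continuous_Re.
have /compact_bounded : compact (g @` K).
  by apply: continuous_compact => //; exact: continuous_subspaceT.
move=> [M [_ MP]].
exists (Num.max 1 (M + 1)); first by rewrite lt_max ltr01.
move=> z Kz; rewrite -Re_normE lecR; apply: le_trans (ler_norm _) _.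
apply: (MP (Num.max 1 (M + 1))); last by exists z.
by rewrite lt_max ltrDl ltr01 orbT.
Qed.

Lemma dense_hol_approx (D : set (hol G)) : dense D ->
  forall (v : hol G) (K : set G) (e : R), compact K -> 0 < e ->
  exists2 d, D d & forall z, K z -> `|v z - d z| < e%:C.
Proof.
move=> dD v K e cK e0.
have e0' : 0 < e%:C :> Cplx R by rewrite ltcR.
have C := @initial_continuous _ _ (@hol_compact R G).
have := C v _ (@fam_nbhs _ _ _ K _ (hol_compact v)
   (entourage_ball (Cplx R) (PosNum e0')) cK).
rewrite /= nbhs_simpl nbhsE => -[U [Uo Uv] sU].
have [d [Ud Dd]] := dD U (ex_intro _ v Uv) Uo.
by exists d => //; exact: sU.
Qed.

(** The topology is a supremum over all compact sets, so a neighbourhood of [v]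
    a priori involves finitely many of them.  The filter generated by the sets
    of elements of [D] close to [v] on one compact set takes care of this: it
    converges to [v] as soon as it does so uniformly on each compact set. *)
Lemma approx_dense_hol (D : set (hol G)) :
  (forall (v : hol G) (K : set G) (e : R), compact K -> 0 < e ->
     exists2 d, D d & forall z, K z -> `|v z - d z| < e%:C) -> dense D.
Proof.
move=> H O [v Ov] oO.
pose B := fun p : set G * R =>
  [set d : hol G | D d /\ forall z, p.1 z -> `|v z - d z| < p.2%:C].
pose I := [set p : set G * R | compact p.1 /\ 0 < p.2].
pose F := filter_from I B.
have FF : Filter F.
  apply: filter_from_filter.
    by exists (set0, 1) => //; split => //=; exact: compact0.
  move=> [K e] [K' e'] [/= cK e0] [/= cK' e0'].
  exists (K `|` K', Num.min e e').
    by split => /=; [exact: compactU | rewrite lt_min e0].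
  move=> d [Dd /= dP]; split; split => //= z Kz.
    apply: lt_le_trans (dP _ (or_introl Kz)) _.
    by rewrite lecR ge_min lexx.
  apply: lt_le_trans (dP _ (or_intror Kz)) _.
  by rewrite lecR ge_min lexx orbT.
have Fv : {family compact, (@hol_compact R G) @ F --> hol_compact v}.
  apply/fam_cvgP => K cK P /uniform_nbhs[E [entE EP]].
  move: entE; rewrite -entourage_ballE => -[_ /= /gt0_real_complex[e e0 ->] eE].
  exists (K, e) => // d [_ /= dP].
  by apply: EP => z /dP zP; apply: eE.
case: oO => A oA AO.
have : ((@hol_compact R G) @ F) A.
  by apply: Fv; apply: open_nbhs_nbhs; split => //; rewrite -AO in Ov.
move=> [[K e] [/= cK e0] BA].
have [d Dd dP] := H v K e cK e0.
by exists d; split => //; rewrite -AO; apply: BA.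
Qed.

End hol_topology.

(** * Orbits of a hypercyclic vector *)

Section orbit.
Context (R : realType) (G : domain R) (phi : selfmap G).
Local Notation T := (comp_op phi).
Local Open Scope complex_scope.

Lemma iter_comp_op n (g : hol G) z : iter n T g z = g (iter n phi z).
Proof. by elim: n z => // n IH z; rewrite iterS iterSr -IH. Qed.

Lemma compact_iter_image n (K : set G) :
  compact K -> compact (iter n phi @` K).
Proof.
elim: n K => [|n IH] K cK; first by rewrite image_id.
rewrite (_ : _ @` _ = iter n phi @` (phi @` K)).
  apply: IH; apply: continuous_compact => //; apply: continuous_subspaceT.
  exact: continuous_selfmap.
by rewrite image_comp; apply: eq_imagel => z _; exact: iterSr.
Qed.

Lemma HC_approx (f : hol G) : HC T f ->
  forall (v : hol G) (K : set G) (e : R), compact K -> 0 < e ->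
  exists2 n, (0 < n)%N & forall z, K z -> `|v z - f (iter n phi z)| < e%:C.
Proof.
move=> hf v K e cK e0.
have [_ [n n0 <-] nP] := dense_hol_approx hf v cK e0.
by exists n => // z /nP; rewrite iter_comp_op.
Qed.

Lemma approx_HC (f : hol G) :
  (forall (v : hol G) (K : set G) (e : R), compact K -> 0 < e ->
   exists2 n, (0 < n)%N & forall z, K z -> `|v z - f (iter n phi z)| < e%:C) ->
  HC T f.
Proof.
move=> H; apply: approx_dense_hol => v K e cK e0.
have [n n0 nP] := H v K e cK e0.
exists (iter n T f); first by exists n.
by move=> z /nP; rewrite iter_comp_op.
Qed.

Context (f : hol G) (hf : HC T f).

(** The tails of the orbit are dense as well.  To discard the time [N + 1] in
    the induction, look at one point [z0]: if [T^(N+1) f] differs from [v] there,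
    it is excluded by a smaller tolerance; otherwise it is excluded by aiming at
    [v + e / 2] instead of [v]. *)
Lemma HC_tail (N : nat) (v : hol G) (K : set G) (e : R) :
  compact K -> 0 < e ->
  exists2 n, (N < n)%N & forall z, K z -> `|v z - f (iter n phi z)| < e%:C.
Proof.
have [z0 _] := domain_point G.
move=> cK; have : compact (K `|` [set z0]) by exact/compactU/compact_set1.
have : (K `|` [set z0]) z0 by right.
have : K `<=` K `|` [set z0] by left.
move: (K `|` _) => L KL Lz0 {}cK.
move=> e0; suff [n Nn nP] : exists2 n, (N < n)%N &
    forall z, L z -> `|v z - f (iter n phi z)| < e%:C.
  by exists n => // z /KL /nP.
elim: N v e e0 => [|N IH] v e e0; first exact: HC_approx.
have [E|/eqP NE] := eqVneq (v z0) (f (iter N.+1 phi z0)).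
  have e2 : 0 < e / 2 by rewrite divr_gt0.
  have [n Nn nP] := IH (v + hol_cst G (e / 2)%:C) _ e2.
  exists n.
    rewrite ltn_neqAle Nn andbT; apply/eqP => nE.
    have := nP _ Lz0; rewrite -nE -E holD hol_cstE [X in `|X|]addrAC subrr add0r.
    by rewrite norm_real_complex ger0_norm ?ltxx// ltW.
  move=> z Lz; have := nP _ Lz; rewrite holD hol_cstE => H.
  have -> : v z - f (iter n phi z) =
    v z + (e / 2)%:C - f (iter n phi z) - (e / 2)%:C by ring.
  apply: le_lt_trans (ler_normB _ _) _.
  rewrite norm_real_complex (ger0_norm (ltW e2)).
  by rewrite [e in ltRHS]splitr rmorphD ltrD2r.
pose d := complex.Re `|v z0 - f (iter N.+1 phi z0)|.
have d0 : 0 < d by rewrite -ltcR Re_normE normr_gt0 subr_eq0; exact/eqP.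
have ed0 : 0 < Num.min e d by rewrite lt_min e0.
have [n Nn nP] := IH v _ ed0.
exists n.
  rewrite ltn_neqAle Nn andbT; apply/eqP => nE.
  by have := nP _ Lz0; rewrite -nE -Re_normE ltcR lt_min ltxx andbF.
move=> z Lz; apply: lt_le_trans (nP _ Lz) _.
by rewrite lecR ge_min lexx.
Qed.

Lemma orbit_seq (w : nat -> hol G) (e : nat -> R) (K : set G) :
  compact K -> (forall m, 0 < e m) ->
  exists j : nat -> nat, forall m, (0 < j m)%N /\
    forall z, K z -> `|w m z - f (iter (j m) phi z)| < (e m)%:C.
Proof.
move=> cK e0.
have /choice[j jP] : forall m, exists n, (0 < n)%N /\
    forall z, K z -> `|w m z - f (iter n phi z)| < (e m)%:C.
  by move=> m; have [n n1 n2] := HC_approx hf (w m) cK (e0 m); exists n.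
by exists j.
Qed.

(** Along an eventually periodic orbit of [phi] the function [f] would be
    bounded, hence unable to approximate large constants. *)
Lemma orbit_inj (z : G) : injective (fun n => iter n phi z).
Proof.
suff H i k : iter (i + k.+1) phi z != iter i phi z.
  move=> i j /eqP E; apply/eqP; apply: contraTT E.
  rewrite neq_ltn => /orP[] /subnK <-; last first.
    by rewrite -addSnnS addnC; exact: H.
  by rewrite eq_sym -addSnnS addnC; exact: H.
apply/eqP => E.
pose M : Cplx R := \sum_(l < (i + k.+1)) `|f (iter l phi z)|.
have Mb n : `|f (iter n phi z)| <= M.
  have [l lik ->] : exists2 l, (l < i + k.+1)%N & iter n phi z = iter l phi z.
    elim: n => [|n [l ll nl]]; first by exists 0%N => //; rewrite addnS.
    move: ll; rewrite leq_eqVlt => /orP[/eqP lE|ll]; last first.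
      by exists l.+1; rewrite //= nl.
    by exists i; rewrite ?addnS ?leq_addr//= nl -E -lE.
  by rewrite /M (bigD1 (Ordinal lik))//= lerDl sumr_ge0.
have M0 : 0 <= M by apply: sumr_ge0.
have cz : compact [set z] by exact: compact_set1.
have [n _ nP] := HC_approx hf (hol_cst G (M + 1)) cz ltr01.
have := nP z erefl; rewrite hol_cstE.
move=> lt1.
have : `|M + 1| <= `|M + 1 - f (iter n phi z)| + `|f (iter n phi z)|.
  by rewrite -{1}(subrK (f (iter n phi z)) (M + 1)) ler_normD.
rewrite (@ger0_norm _ (M + 1)) ?addr_ge0// => H1.
have := lerD (lexx `|M + 1 - f (iter n phi z)|) (Mb n).
move/(le_trans H1); rewrite [leLHS]addrC lerD2r => H2.
by have : (1 : Cplx R) < 1 := le_lt_trans H2 lt1; rewrite ltxx.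
Qed.

Lemma exists_interpolant (z0 : G) (n1 : nat) (s : seq nat) :
  exists w : hol G, w (iter n1 phi z0) != 0 /\
    forall k, k \in s -> k != n1 -> w (iter k phi z0) = 0.
Proof.
pose x k := val (iter k phi z0) : Cplx R.
exists (\prod_(k <- s | k != n1) (hol_val G - hol_cst G (x k))); split.
  rewrite hol_prod prodf_seq_neq0; apply/allP => k ks; apply/implyP => kn1.
  rewrite holB hol_cstE subr_eq0; apply: contra kn1 => /eqP/val_inj.
  by move=> /orbit_inj ->.
move=> k ks kn1.
have E : (hol_val G - hol_cst G (x k)) (iter k phi z0) = 0.
  by rewrite holB hol_cstE; exact: subrr.
by rewrite hol_prod (big_rem k ks) kn1 E; exact: mul0r.
Qed.

End orbit.

(** * Products of twisted iterates *)

Section twist.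
Context (R : realType) (G : domain R) (phi : selfmap G).
Local Notation T := (comp_op phi).
Local Open Scope complex_scope.

Definition twist (f : hol G) (n : nat) (d : Cplx R) : hol G :=
  iter n T f * (1 - d *: hol_exp f).

Lemma twistE f n d j z : twist f n d (iter j phi z) =
  f (iter j phi (iter n phi z)) * (1 - d * expC (f (iter j phi z))).
Proof.
by rewrite /twist holM holB holZ hol1 iter_comp_op -!iterD addnC.
Qed.

Context (f : hol G) (hf : HC T f).

(** The factor with coefficient [d1] has a zero at each of the constants
    [a m = a0 + 2 i pi m], which no other factor shares.  Along times [j m] at
    which [f] is close to [a m + v / rho m], the product converges to [v]
    uniformly on [K]: it equals [rho m * t 0 * Th], where [t 0] is the
    difference between [T^(j m) f] and [a m], so that [rho m * t 0] tends to [v],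
    and [Th] collects relative errors and tends to [1]. *)
Lemma prod_twist_HC (n1 : nat) (d1 a0 : Cplx R) (I : eqType) (s : seq I)
    (nu : I -> nat) (d : I -> Cplx R) :
  d1 * expC a0 = 1 -> (forall i, i \in s -> d i != d1) ->
  HC T (twist f n1 d1 * \prod_(i <- s) twist f (nu i) (d i)).
Proof.
move=> da0 dneq; apply: approx_HC => v K e cK e0.
have d10 : d1 != 0.
  apply/eqP => d10; have := oner_neq0 (Cplx R).
  by rewrite -da0 d10 mul0r eqxx.
have ea0 : expC a0 = d1^-1 by apply: (mulfI d10); rewrite da0 divff.
pose a m := a0 + log_period R *+ m.
have ea m : expC (a m) = d1^-1 by rewrite expC_period.
pose q i := d i / d1.
pose C := \prod_(i <- s) (1 - q i).
have C0 : C != 0.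
  rewrite prodf_seq_neq0; apply/allP => i si /=.
  rewrite subr_eq0 eq_sym; apply: contra (dneq _ si) => /eqP qi.
  by rewrite -[d i](divfK d10) -/(q i) qi mul1r.
(* [size s + 1] factors [T^k f], each close to [a m]; the sign comes from
   [1 - e^t ~ - t] *)
pose rho m := - (a m ^+ (size s).+1 * C).
pose w m := hol_cst G (a m) + (rho m)^-1 *: v.
(* the error on [f] is multiplied by [rho m]; the summand [1] keeps the
   tolerance meaningful for the few [m] with [rho m = 0] *)
pose err m : R := m.+1%:R^-1 / (complex.Re `|rho m| + 1).
have err0 m : 0 < err m.
  by rewrite divr_gt0// ?invr_gt0// ltr_wpDl// Re_norm_ge0.
pose L := \big[setU/set0]_(k <- [:: 0%N, n1 & map nu s]) (iter k phi @` K).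
have cL : compact L.
  by apply: bigsetU_compact => k _; exact: compact_iter_image.
pose good k := k \in [:: 0%N, n1 & map nu s].
have KL k z : good k -> K z -> L (iter k phi z).
  by move=> gk Kz; rewrite /L -bigcup_seq; exists k => //; exists z.
have [j jP] := orbit_seq hf w cL err0.
have [F [FF fstF KF Fend]] := uniform_filterP K.
pose t k (x : nat * G) := f (iter (j x.1) phi (iter k phi x.2)) - a x.1.
have b0 : (fun x : nat * G => (a x.1)^-1) @ F --> (0 : Cplx R).
  apply: cvg_comp (@cvg_inv_shift R a0 _ (log_period_neq0 R)) => S.
  exact: fstF.
have a_neq0 : \forall x \near F, a x.1 != 0.
  apply: (fstF (fun m => is_true (a m != 0))).
  have := near_shift_ge a0 1 (log_period_neq0 R).
  apply: filterS => m H; rewrite -normr_gt0; apply: lt_le_trans H.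
  by rewrite ltcR.
have rho0 : (fun x : nat * G => (rho x.1)^-1) @ F --> (0 : Cplx R).
  have H : (fun x : nat * G => (a x.1)^-1 ^+ (size s).+1 * - C^-1) @ F -->
      (0 * - C^-1 : Cplx R).
    by apply: cvgM; [exact: cvg_exprS0 | exact: cvg_cst].
  rewrite mul0r in H; apply: (cvg_near_eq _ H); near=> x => /=.
  by rewrite /rho invrN invfM exprVn mulrN.
have uv k : good k ->
    (fun x => rho x.1 * t k x - v (iter k phi x.2)) @ F --> (0 : Cplx R).
  move=> gk; apply: (@cvg_dominated _ _ _ _ _ (fun x => (x.1.+1%:R)^-1)).
    near=> x.
    have Kx : K x.2 by near: x.
    have ax : a x.1 != 0 by near: x.
    have rx : rho x.1 != 0 by rewrite oppr_eq0 mulf_neq0// expf_neq0.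
    have [_ /(_ _ (KL _ _ gk Kx))] := jP x.1.
    set y := f _ => yP.
    have -> : rho x.1 * t k x - v (iter k phi x.2) =
        - (rho x.1 * (w x.1 (iter k phi x.2) - y)).
      rewrite /w holD hol_cstE holZ /t -/y; field.
      exact: rx.
    rewrite normrN normrM.
    apply: le_trans (_ : `|rho x.1| * (err x.1)%:C <= _).
      by apply: ler_wpM2l; [exact: normr_ge0 | exact: ltW].
    rewrite -Re_normE -rmorphM lecR /err mulrCA ler_piMr ?invr_ge0//.
    have r0 := Re_norm_ge0 (rho x.1).
    by rewrite ler_pdivrMr ?mul1r ?lerDl// ltr_wpDl.
  by apply: cvg_comp (@cvg_harmonic R) => S; exact: fstF.
have tk k : good k -> t k @ F --> (0 : Cplx R).
  move=> gk; have [M _ MP] := hol_bounded (iter k T v) cK.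
  have vr : (fun x => v (iter k phi x.2) * (rho x.1)^-1) @ F --> (0 : Cplx R).
    apply: (@cvg_bounded_mul _ _ _ _ _ _ M) => //.
    by near=> x; rewrite -iter_comp_op; apply: MP; near: x.
  have H : (fun x => (rho x.1 * t k x - v (iter k phi x.2)) * (rho x.1)^-1 +
      v (iter k phi x.2) * (rho x.1)^-1) @ F --> (0 * 0 + 0 : Cplx R).
    by apply: cvgD; [apply: cvgM; [exact: uv | exact: rho0] | exact: vr].
  rewrite mulr0 addr0 in H; apply: (cvg_near_eq _ H); near=> x => /=.
  have ax : a x.1 != 0 by near: x.
  have rx : rho x.1 != 0 by rewrite oppr_eq0 mulf_neq0// expf_neq0.
  by rewrite -mulrDl subrK mulrAC divff// mul1r.
have g0 : good 0%N by rewrite /good mem_head.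
have g1 : good n1 by rewrite /good !inE eqxx orbT.
have gs i : i \in s -> good (nu i) by move=> si; rewrite /good !inE map_f ?orbT.
pose y k x : Cplx R := 1 + t k x / a x.1.
have y1 k : good k -> y k @ F --> (1 : Cplx R).
  move=> gk; rewrite -[1 in X in _ --> X]addr0 -(mulr0 (0 : Cplx R)).
  apply: cvgD; first exact: cvg_cst.
  by apply: cvgM; [exact: tk | exact: b0].
pose Th x : Cplx R := y n1 x * expC_quot (t 0%N x) * C^-1 *
  \prod_(i <- s) (y (nu i) x * (1 - q i * expC (t 0%N x))).
have Th1 : Th @ F --> (1 : Cplx R).
  have -> : 1 = 1 * 1 * C^-1 * \prod_(i <- s) (1 * (1 - q i * 1)) :> Cplx R.
    under eq_bigr do rewrite mul1r mulr1.
    by rewrite !mul1r mulVf.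
  apply: cvgM.
    apply: cvgM; last exact: cvg_cst.
    apply: cvgM; first exact: y1.
    exact: cvg_comp (tk _ g0) (@cvg_expC_quot R).
  apply: cvg_prod_seq => i si; apply: cvgM; first exact: y1 (gs _ si).
  apply: cvgB; first exact: cvg_cst.
  apply: cvgM; first exact: cvg_cst.
  rewrite -(expC0 R); apply: cvg_comp (tk _ g0) _.
  exact: continuous_expC.
pose P := twist f n1 d1 * \prod_(i <- s) twist f (nu i) (d i).
have PE : \forall x \near F,
    P (iter (j x.1) phi x.2) = rho x.1 * t 0%N x * Th x.
  near=> x.
  have ax : a x.1 != 0 by near: x.
  have fE k : f (iter (j x.1) phi (iter k phi x.2)) = a x.1 * y k x.
    by rewrite /y mulrDr mulr1 mulrCA divff// mulr1 /t addrC subrK.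
  have eE : expC (f (iter (j x.1) phi x.2)) = d1^-1 * expC (t 0%N x).
    by rewrite -(ea x.1) -expCD /t addrC subrK.
  rewrite /P holM hol_prod twistE fE eE mulrA divff// mul1r.
  under eq_bigr do rewrite twistE fE eE mulrA -/(q _) -mulrA.
  rewrite big_split/= big_const_seq count_predT iter_mulr mulr1 /Th /rho.
  have -> : 1 - expC (t 0%N x) = - (t 0%N x * expC_quot (t 0%N x)).
    by rewrite -expC_quotE opprB.
  rewrite exprS; field.
  exact: C0.
have Plim : (fun x => v x.2 - P (iter (j x.1) phi x.2)) @ F --> (0 : Cplx R).
  have [M _ MP] := hol_bounded v cK.
  have c1 : (fun x => Th x - 1) @ F --> (0 : Cplx R).
    rewrite -(subrr (1 : Cplx R)).
    by apply: cvgB; [exact: Th1 | exact: cvg_cst].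
  have c2 : (fun x => v x.2 * (Th x - 1)) @ F --> (0 : Cplx R).
    apply: (@cvg_bounded_mul _ _ _ _ _ _ M) => //.
    by near=> x; apply: MP; near: x.
  have H : (fun x => - ((rho x.1 * t 0%N x - v x.2) * Th x +
      v x.2 * (Th x - 1))) @ F --> (- (0 * 1 + 0) : Cplx R).
    apply: cvgN; apply: cvgD; last exact: c2.
    by apply: cvgM; [exact: (uv _ g0) | exact: Th1].
  rewrite mulr1 add0r oppr0 in H; apply: (cvg_near_eq _ H).
  near=> x; cbv beta.
  have -> : P (iter (j x.1) phi x.2) = rho x.1 * t 0%N x * Th x by near: x.
  by ring.
have e0' : 0 < e%:C :> Cplx R by rewrite ltcR.
move/(@cvgr0Pnorm_lt (Cplx R) (Cplx R)) : Plim => /(_ _ e0').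
move=> /Fend[m mP]; exists (j m); first exact: (jP m).1.
exact: mP.
Unshelve. all: by end_near. Qed.

End twist.

(** * The family *)

Section twisted_orbit.
Context (R : realType) (G : domain R) (phi : selfmap G) (f : hol G).
Local Notation T := (comp_op phi).
Local Open Scope complex_scope.
Context (hf : HC T f).

(** The coefficients must be pairwise distinct, tend to [0], and be nonzero,
    hence values of the exponential, for [n > 0]; the value [0] at [n = 0] makes
    [f] itself the first member of the family. *)
Definition twist_coef (n : nat) : Cplx R :=
  if n == 0%N then 0 else (expR (- n%:R : R))%:C.

Definition twisted_orbit (n : nat) : hol G := twist phi f n (twist_coef n).

Lemma twist_coef_inj : injective twist_coef.
Proof.
have e0 (x : R) : ((expR x)%:C == 0 :> Cplx R) = false.
  by apply/eqP => /(congr1 (@complex.Re R))/= /eqP; rewrite expR_eq0.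
move=> [|n] [|m] //; rewrite /twist_coef/=; move=> /eqP.
- by rewrite eq_sym e0.
- by rewrite e0.
by move=> /eqP/complexI/expR_inj/oppr_inj/eqP; rewrite eqr_nat => /eqP.
Qed.

Lemma twist_coef_neq1 n : twist_coef n != 1.
Proof.
rewrite /twist_coef; case: (eqVneq n 0%N) => [_|n0].
  by rewrite eq_sym oner_eq0.
apply/eqP => /(congr1 (@complex.Re R)) /= E.
have : expR (- n%:R : R) < 1 by rewrite expR_lt1 oppr_lt0 ltr0n lt0n.
by rewrite E ltxx.
Qed.

Lemma twisted_orbit0 : twisted_orbit 0 = f.
Proof.
by rewrite /twisted_orbit /twist /twist_coef eqxx scale0r subr0 mulr1.
Qed.

Lemma twisted_orbit_index (F0 : {fset hol G}) :
  [set` F0] `<=` range twisted_orbit ->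
  exists nu : hol G -> nat, {in F0, forall g, twisted_orbit (nu g) = g}.
Proof.
move=> sub.
have /choice[nu nuP] : forall g, exists n, g \in F0 -> twisted_orbit n = g.
  move=> g; case: (boolP (g \in F0)) => [gF|_]; last by exists 0%N.
  by have [n _ nE] := sub g gF; exists n.
by exists nu.
Qed.

Lemma twisted_orbit_prod_HC (n1 : nat) (I : eqType) (s : seq I)
    (nu : I -> nat) :
  n1 != 0%N -> (forall i, i \in s -> nu i != n1) ->
  HC T (twisted_orbit n1 * \prod_(i <- s) twisted_orbit (nu i)).
Proof.
move=> n10 nuP; apply: (@prod_twist_HC _ _ _ _ hf _ _ (n1%:R : R)%:C).
  by rewrite expC_real /twist_coef (negbTE n10) -rmorphM/= -expRD addNr expR0.
by move=> i /nuP; rewrite (inj_eq twist_coef_inj).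
Qed.

Lemma twisted_orbit_HC n : HC T (twisted_orbit n).
Proof.
have [->|n0] := eqVneq n 0%N; first by rewrite twisted_orbit0.
have := @twisted_orbit_prod_HC n nat [::] id n0.
by rewrite big_nil mulr1; exact.
Qed.

(** Either some member [g_n] with [n > 0] occurs, and the product is governed by
    the zeros of its exponential factor, or the product is [f]. *)
Lemma twisted_orbit_prod_fset_HC (F0 : {fset hol G}) :
  F0 != fset0 -> [set` F0] `<=` range twisted_orbit ->
  HC T (\prod_(g <- F0) g).
Proof.
move=> /fset0Pn[g0 g0F] /twisted_orbit_index[nu nuP].
case: (pselect (exists2 g, g \in F0 & nu g != 0%N)) => [[g gF ng]|H]; last first.
  have all0 g : g \in F0 -> g = f.
    move=> gF; rewrite -(nuP _ gF); case: (eqVneq (nu g) 0%N) => [->|n0].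
      exact: twisted_orbit0.
    by case: H; exists g.
  have -> : F0 = [fset f]%fset.
    apply/fsetP => g; rewrite inE; apply/idP/eqP => [/all0//|->].
    by rewrite -(all0 _ g0F).
  by rewrite big_seq_fset1.
rewrite (big_rem g gF)/= (eq_big_seq (fun h => twisted_orbit (nu h))); last first.
  by move=> h /mem_rem hF; rewrite nuP.
rewrite -[X in X * _](nuP _ gF); apply: twisted_orbit_prod_HC => // h hF.
apply: contraTneq hF => E; rewrite mem_rem_uniq ?fset_uniq// inE/=.
apply/nandP; case: (boolP (h \in F0)) => hF; last by right.
by left; rewrite negbK -(nuP _ gF) -(nuP _ hF) E.
Qed.

Lemma dense_twisted_orbit : dense (range twisted_orbit).
Proof.
apply: approx_dense_hol => v K e cK e0.
have [M1 M10 M1P] := hol_bounded (hol_exp f) cK.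
have [M2 M20 M2P] := hol_bounded v cK.
have e2 : 0 < e / 2 by rewrite divr_gt0.
have B0 : 0 < M1 * (M2 + e) by rewrite mulr_gt0// addr_gt0.
have : \forall n \near \oo, expR (- n%:R : R) < e / 2 / (M1 * (M2 + e)).
  have B1 : 0 < e / 2 / (M1 * (M2 + e)) by rewrite divr_gt0.
  have := @cvgn_expR R; move/(@cvgr0Pnorm_lt R R) => /(_ _ B1).
  by apply: filterS => n; apply: le_lt_trans; exact: ler_norm.
move=> [N _ NP].
have [n Nn nP] := HC_tail hf N v cK e2.
exists (twisted_orbit n); first by exists n.
move=> z Kz; have := twistE phi f n (twist_coef n) 0 z.
rewrite /= -/(twisted_orbit n) => ->.
set y := f _; have yP : `|v z - y| < (e / 2)%:C by exact: nP.
have -> : v z - y * (1 - twist_coef n * expC (f z)) =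
  (v z - y) + twist_coef n * (expC (f z) * y) by ring.
apply: le_lt_trans (ler_normD _ _) _.
rewrite [e in ltRHS]splitr rmorphD; apply: ltrD => //.
have yM : `|y| <= (M2 + e)%:C.
  rewrite -(subKr (v z) y); apply: le_trans (ler_normB _ _) _.
  rewrite rmorphD; apply: lerD; first exact: M2P.
  by apply: le_trans (ltW yP) _; rewrite lecR; lra.
have -> : twist_coef n = (expR (- n%:R))%:C.
  by rewrite /twist_coef gtn_eqF// (leq_ltn_trans (leq0n N)).
rewrite normrM normrM norm_real_complex (ger0_norm (expR_ge0 _)).
apply: le_lt_trans (_ : (expR (- n%:R))%:C * ((M1%:C) * (M2 + e)%:C) < _).
  apply: ler_wpM2l; first by rewrite ler0c expR_ge0.
  by apply: ler_pM => //; exact: M1P.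
by rewrite -!rmorphM ltcR -ltr_pdivlMr//; apply: NP; exact: ltnW.
Qed.

(** Along times at which [f] is close to [w] on finitely many points of the
    orbit of [z0], a relation [sum c_v v = 0] becomes, in the limit, the same
    relation at [z0] with [f] replaced by [w].  When [w] vanishes at
    [phi^k(z0)] for all relevant [k] except [nu v0], only the term of [v0]
    remains. *)
Lemma linearly_independent_twisted_orbit :
  linearly_independent (range twisted_orbit).
Proof.
move=> F0 c /twisted_orbit_index[nu nuP] c0 v0 v0F.
have [z0 _] := domain_point G.
(* [0] is included so that [w z0 = 0], hence [e^w = 1] at [z0], when
   [nu v0 != 0] *)
pose s := 0%N :: map nu F0.
have [w [w1 w0]] := exists_interpolant hf z0 (nu v0) s.
pose K := \big[setU/set0]_(k <- s) [set iter k phi z0].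
have cK : compact K by apply: bigsetU_compact => k _; exact: compact_set1.
have Ks k : k \in s -> K (iter k phi z0).
  by move=> ks; rewrite /K -bigcup_seq; exists k.
have e0 m : 0 < m.+1%:R^-1 :> R by rewrite invr_gt0.
have [j jP] := orbit_seq hf (fun=> w) cK e0.
have jw k : k \in s ->
    (fun m => f (iter (j m) phi (iter k phi z0))) @ \oo --> w (iter k phi z0).
  move=> ks; rewrite -[X in _ --> X]subr0.
  have d0 : (fun m => w (iter k phi z0) - f (iter (j m) phi (iter k phi z0)))
      @ \oo --> (0 : Cplx R).
    apply: (@cvg_dominated _ _ _ _ _ (fun m => (m.+1%:R)^-1)).
      by near=> m; apply: ltW; apply: (jP m).2; exact: Ks.
    exact: cvg_harmonic.
  have H : (fun m => w (iter k phi z0) -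
      (w (iter k phi z0) - f (iter (j m) phi (iter k phi z0)))) @ \oo -->
      (w (iter k phi z0) - 0 : Cplx R).
    by apply: cvgB; [exact: cvg_cst | exact: d0].
  by apply: (cvg_near_eq _ H); near=> m; cbv beta; rewrite subKr.
have jw0 := jw 0%N (mem_head _ _).
pose Q v (x y : Cplx R) := c v * (x * (1 - twist_coef (nu v) * expC y)).
have sum0 m : \sum_(v <- F0)
    Q v (f (iter (j m) phi (iter (nu v) phi z0))) (f (iter (j m) phi z0)) = 0.
  have := congr1 (fun g : hol G => g (iter (j m) phi z0)) c0.
  rewrite hol_sum => E; rewrite -[RHS]E.
  apply: eq_big_seq => v vF; rewrite holZ /Q; congr (_ * _).
  by rewrite -twistE -/(twisted_orbit _) nuP.
have suml : \sum_(v <- F0) Q v (w (iter (nu v) phi z0)) (w z0) =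
    Q v0 (w (iter (nu v0) phi z0)) (w z0).
  rewrite (big_rem v0 v0F)/= big1_seq ?addr0// => v /= vr.
  move: vr; rewrite mem_rem_uniq ?fset_uniq// inE/= => /andP[vv0 vF].
  rewrite /Q w0 ?mul0r ?mulr0//; first by rewrite inE map_f ?orbT.
  by apply: contra vv0 => /eqP E; rewrite -(nuP _ vF) -(nuP _ v0F) E.
have lim0 : (fun m => \sum_(v <- F0)
    Q v (f (iter (j m) phi (iter (nu v) phi z0))) (f (iter (j m) phi z0)))
    @ \oo --> \sum_(v <- F0) Q v (w (iter (nu v) phi z0)) (w z0).
  apply: cvg_sum_seq => v vF.
  apply: cvgM; first exact: cvg_cst.
  apply: cvgM; first by apply: jw; rewrite inE map_f ?orbT.
  apply: cvgB; first exact: cvg_cst.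
  apply: cvgM; first exact: cvg_cst.
  exact: cvg_comp jw0 (@continuous_expC R _).
have : Q v0 (w (iter (nu v0) phi z0)) (w z0) = 0.
  rewrite -suml; apply: (cvg_unique (@norm_hausdorff (Cplx R) (Cplx R)) lim0).
  have H : (fun=> 0 : Cplx R) @ \oo --> (0 : Cplx R) by exact: cvg_cst.
  by apply: (cvg_near_eq _ H); near=> m; cbv beta; rewrite sum0.
move=> /eqP; rewrite /Q !mulf_eq0 (negbTE w1)/= => /orP[/eqP//|].
rewrite subr_eq0 eq_sym.
have [n0|n0] := eqVneq (nu v0) 0%N.
  by rewrite n0 /twist_coef eqxx mul0r eq_sym oner_eq0.
have -> : w z0 = 0 by apply: (w0 0%N); rewrite ?mem_head// eq_sym.
by rewrite expC0 mulr1 (negbTE (twist_coef_neq1 _)).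
Unshelve. all: by end_near. Qed.

End twisted_orbit.

Theorem theorem3p4 (R : realType) (G : domain R) (phi : selfmap G)
    (hG : simply_connected G) (hphi : Aut G phi)
    (nofix : forall z : G, phi z <> z) (f : hol G) (hf : HC (comp_op phi) f) :
  exists F : set (hol G),
    [/\ F f /\ F `<=` HC (comp_op phi),
        dense F,
        forall F0 : {fset hol G}, F0 != fset0 -> [set` F0] `<=` F ->
          HC (comp_op phi) (\prod_(g <- F0) g)
      & linearly_independent F].
Proof.
exists (range (twisted_orbit phi f)); split.
- split; first by exists 0%N => //; exact: twisted_orbit0.
  by move=> _ [n _ <-]; exact: twisted_orbit_HC.
- exact: dense_twisted_orbit.
- exact: twisted_orbit_prod_fset_HC.
- exact: linearly_independent_twisted_orbit.
Qed.
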